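(* The calculus D.LRC is conservative over the Hilbert system H.LRC: for all LRC-formulas $A$ and $B$, if $A\vdash B$ is a derivable sequent of D.LRC, then $A\vdash_{\mathrm{LRC}}B$.
   Context: LANGUAGE. Fix countable disjoint sets $\mathsf{AtProp}$ and $\mathsf{AtRes}$. Resource terms: $\alpha::=a\in\mathsf{AtRes}\mid 1\mid 0\mid\alpha\cdot\alpha\mid\alpha\sqcup\alpha\mid\alpha\sqcap\alpha$. LRC-formulas: $A::=p\in\mathsf{AtProp}\mid\top\mid\bot\mid A\vee A\mid A\wedge A\mid A\to A\mid\alpha\vartriangleright A\mid\Diamond A\mid\Diamond_r\alpha\mid\alpha\vartriangleright_r\alpha$. $\Diamond,\Diamond_r,\vartriangleright,\vartriangleright_r$ bind more strongly than $\wedge,\vee$, which bind more strongly than $\to$. HILBERT SYSTEM H.LRC. Resource entailment $\alpha\vdash\beta$ is the least preorder on resource terms such that: (R1) $\sqcup$ and $\sqcap$ are join and meet and distribute over each other; (R2) $\cdot$ is associative with unit $1$ (up to mutual entailment); (R3) $\alpha\vdash1$ and $0\vdash\alpha$; (R4) $\alpha\cdot(\beta\sqcup\gamma)\vdash(\alpha\cdot\beta)\sqcup(\alpha\cdot\gamma)$ and $(\beta\sqcup\gamma)\cdot\alpha\vdash(\beta\cdot\alpha)\sqcup(\gamma\cdot\alpha)$; (MF, MF') if $\alpha\vdash\beta$ then $\alpha\cdot\gamma\vdash\beta\cdot\gamma$ and $\gamma\cdot\alpha\vdash\gamma\cdot\beta$. The set of LRC-theorems is the least set of formulas containing the axioms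 of intuitionistic propositional logic and all instances of: (D1) $\Diamond(A\vee B)\leftrightarrow\Diamond A\vee\Diamond B$; (D2) $\Diamond\bot\leftrightarrow\bot$; (D3) $\Diamond_r(\alpha\sqcup\beta)\leftrightarrow\Diamond_r\alpha\vee\Diamond_r\beta$; (D4) $\Diamond_r0\leftrightarrow\bot$; (B1) $(\alpha\sqcup\beta)\vartriangleright A\leftrightarrow\alpha\vartriangleright A\wedge\beta\vartriangleright A$; (B2) $0\vartriangleright A$; (B3) $\alpha\vartriangleright(\beta\vartriangleright A)\to(\alpha\cdot\beta)\vartriangleright A$; (B4) $(\alpha\sqcup\beta)\vartriangleright_r\gamma\leftrightarrow\alpha\vartriangleright_r\gamma\wedge\beta\vartriangleright_r\gamma$; (B5) $0\vartriangleright_r\alpha$; (B6) $\alpha\vartriangleright_r(\beta\sqcap\gamma)\leftrightarrow\alpha\vartriangleright_r\beta\wedge\alpha\vartriangleright_r\gamma$; (B7) $\alpha\vartriangleright_r1$; (BD1) $\Diamond_r\alpha\wedge\alpha\vartriangleright A\to\Diamond A$; (BD2) $\alpha\vartriangleright_r\beta\to\alpha\vartriangleright\Diamond_r\beta$; closed under modus ponens, uniform substitution and the rules: if $A\to B$ is a theorem, so are $\alpha\vartriangleright A\to\alpha\vartriangleright B$ (MB) and $\Diamond A\to\Diamond B$ (MD); if $\alpha\vdash\beta$, then $\beta\vartriangleright A\to\alpha\vartriangleright A$ (AB), $\Diamond_r\alpha\to\Diamond_r\beta$ (MD'), $\gamma\vartriangleright_r\alpha\to\gamma\vartriangleright_r\beta$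 (MB'), $\beta\vartriangleright_r\gamma\to\alpha\vartriangleright_r\gamma$ (AB') are theorems. $A\vdash_{\mathrm{LRC}}B$ means that $A\to B$ is an LRC-theorem. STRUCTURES OF D.LRC. Structures are of type Fm ($X,Y,Z,W$) or Res ($\Gamma,\Delta,\Sigma,\Pi$), and occur in antecedent ($a$) or succedent ($s$) position. With $A$ ranging over formulas and $\alpha$ over resource terms: $X_a::=A\mid\mathrm{I}\mid X_a;X_a\mid X_s>X_a\mid X_a<X_s\mid\circ X_a\mid\circ_r\Gamma_a$; $X_s::=A\mid\mathrm{I}\mid X_s;X_s\mid X_a>X_s\mid X_s<X_a\mid\bullet X_s\mid\Gamma_a\,\hat{\vartriangleright}\,X_s\mid\Gamma_a\,\hat{\vartriangleright}_r\,\Gamma_s$; $\Gamma_a::=\alpha\mid\Phi\mid\Gamma_a\odot\Gamma_a\mid\Gamma_a,\Gamma_a\mid\Gamma_s\sqsupset\Gamma_a\mid\Gamma_a\sqsubset\Gamma_s\mid\Gamma_a\,\hat{\blacktriangle}_r\,X_a$; $\Gamma_s::=\alpha\mid\Phi\mid\Gamma_s,\Gamma_s\mid\Gamma_a\gtrdot\Gamma_s\mid\Gamma_s\lessdot\Gamma_a\mid\Gamma_a\sqsupset\Gamma_s\mid\Gamma_s\sqsubset\Gamma_a\mid\bullet_rX_s\mid X_a\,\hat{\blacktriangleright}\,X_s\mid X_a\,\hat{\blacktriangleright}_r\,\Gamma_s$. Sequents: $X_a\vdash X_s$ or $\Gamma_a\vdash\Gamma_s$ (subscripts omitted below; each rule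 instance must consist of such well-positioned sequents). RULES OF D.LRC (''$S/T$'': from $S$ infer $T$; ''$S\,//\,T$'': both directions). Axioms: $p\vdash p$; $a\vdash a$ (atoms). Cut: $(X\vdash Y)[A]^{succ}$, $A\vdash Z\,/\,(X\vdash Y)[Z/A]^{succ}$ (replacing an occurrence of $A$ as a substructure in succedent position); $\Gamma\vdash\alpha$, $\alpha\vdash\Delta\,/\,\Gamma\vdash\Delta$. Display Fm: $X;Y\vdash Z//Y\vdash X>Z$; $Z\vdash X;Y//X>Z\vdash Y$; $X;Y\vdash Z//X\vdash Z<Y$; $Z\vdash X;Y//Z<Y\vdash X$. Display Res: $\Gamma,\Delta\vdash\Sigma//\Delta\vdash\Gamma\sqsupset\Sigma$; $\Gamma,\Delta\vdash\Sigma//\Gamma\vdash\Sigma\sqsubset\Delta$; $\Gamma\vdash\Delta,\Sigma//\Delta\sqsupset\Gamma\vdash\Sigma$; $\Gamma\vdash\Delta,\Sigma//\Gamma\sqsubset\Sigma\vdash\Delta$; $\Gamma\odot\Delta\vdash\Sigma//\Delta\vdash\Gamma\gtrdot\Sigma$; $\Gamma\odot\Delta\vdash\Sigma//\Gamma\vdash\Sigma\lessdot\Delta$. Display modal: $\circ X\vdash Y//X\vdash\bullet Y$; $\circ_r\Gamma\vdash X//\Gamma\vdash\bullet_rX$; $X\vdash\Gamma\hat{\vartriangleright}Y//\Gamma\vdash X\hat{\blacktriangleright}Y$; $X\vdash\Gamma\hat{\vartriangleright}_r\Delta//\Gamma\hat{\blacktriangle}_rX\vdash\Delta$; $X\vdash\Gamma\hat{\vartriangleright}_r\Delta//\Gamma\vdash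 X\hat{\blacktriangleright}_r\Delta$. Structural Fm: $X\vdash Y//\mathrm{I};X\vdash Y$; $Y\vdash X//Y\vdash X;\mathrm{I}$; $Y;X\vdash Z/X;Y\vdash Z$; $Z\vdash X;Y/Z\vdash Y;X$; $Y\vdash Z/X;Y\vdash Z$; $Z\vdash Y/Z\vdash Y;X$; $X;X\vdash Y/X\vdash Y$; $Y\vdash X;X/Y\vdash X$; $X;(Y;Z)\vdash W//(X;Y);Z\vdash W$; $W\vdash(Z;Y);X//W\vdash Z;(Y;X)$. Structural Res: $\Gamma\odot\Phi\vdash\Delta//\Gamma\vdash\Delta$; $\Gamma\vdash\Delta//\Phi\odot\Gamma\vdash\Delta$; $\Gamma\vdash\Delta//\Gamma\vdash\Delta,\Phi$; $\Gamma\odot(\Delta\odot\Sigma)\vdash\Pi//(\Gamma\odot\Delta)\odot\Sigma\vdash\Pi$; $\Phi\vdash\Delta/\Gamma\vdash\Delta$; $\Gamma\vdash\Delta/\Gamma,\Sigma\vdash\Delta$; $\Gamma\vdash\Delta/\Gamma\vdash\Delta,\Sigma$; $\Gamma,\Gamma\vdash\Delta/\Gamma\vdash\Delta$; $\Gamma\vdash\Delta,\Delta/\Gamma\vdash\Delta$; $\Gamma,\Delta\vdash\Sigma/\Delta,\Gamma\vdash\Sigma$; $\Sigma\vdash\Gamma,\Delta/\Sigma\vdash\Delta,\Gamma$; $\Sigma,(\Delta,\Gamma)\vdash\Pi//(\Sigma,\Delta),\Gamma\vdash\Pi$; $\Pi\vdash\Sigma,(\Delta,\Gamma)//\Pi\vdash(\Sigma,\Delta),\Gamma$;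 $\Pi\vdash(\Gamma\gtrdot\Delta),(\Gamma\gtrdot\Sigma)/\Pi\vdash\Gamma\gtrdot(\Delta,\Sigma)$. D-rules: $X\vdash\bullet Y;\bullet Z/X\vdash\bullet(Y;Z)$; $\Gamma\vdash\bullet_rX,\bullet_rY/\Gamma\vdash\bullet_r(X;Y)$; $X\vdash\mathrm{I}/X\vdash\bullet\mathrm{I}$; $\Gamma\vdash\Phi/\Gamma\vdash\bullet_r\mathrm{I}$. B-rules: $\Gamma\vdash(Y\hat{\blacktriangleright}_r\Delta),(Z\hat{\blacktriangleright}_r\Delta)/\Gamma\vdash(Y;Z)\hat{\blacktriangleright}_r\Delta$; $\Gamma\vdash(Y\hat{\blacktriangleright}W),(Z\hat{\blacktriangleright}W)/\Gamma\vdash(Y;Z)\hat{\blacktriangleright}W$; $(\Gamma\hat{\blacktriangle}_rX),(\Gamma\hat{\blacktriangle}_rY)\vdash\Delta/\Gamma\hat{\blacktriangle}_r(X;Y)\vdash\Delta$; $X\vdash\Gamma\hat{\vartriangleright}(\Delta\hat{\vartriangleright}Y)/X\vdash(\Gamma\odot\Delta)\hat{\vartriangleright}Y$; $\Phi\vdash\Delta/\Gamma\hat{\blacktriangle}_r\mathrm{I}\vdash\Delta$. BD-rules: $X\vdash\Gamma\hat{\vartriangleright}\bullet Y/X\vdash\circ_r\Gamma>Y$; $X\vdash\Gamma\hat{\vartriangleright}_r\bullet_rY/X\vdash\Gamma\hat{\vartriangleright}Y$. Logical Fm: $\bot\vdash\mathrm{I}$; $X\vdash\mathrm{I}/X\vdash\bot$;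 $\mathrm{I}\vdash X/\top\vdash X$; $\mathrm{I}\vdash\top$; $A;B\vdash X/A\wedge B\vdash X$; $X\vdash A,\ Y\vdash B$ (two premises) $/X;Y\vdash A\wedge B$; $A\vdash X$ and $B\vdash Y/A\vee B\vdash X;Y$; $X\vdash A;B/X\vdash A\vee B$; $X\vdash A$ and $B\vdash Y/A\to B\vdash X>Y$; $X\vdash A>B/X\vdash A\to B$. Logical Res: $0\vdash\Phi$; $\Gamma\vdash\Phi/\Gamma\vdash0$; $\Phi\vdash\Gamma/1\vdash\Gamma$; $\Phi\vdash1$; $\alpha\odot\beta\vdash\Gamma/\alpha\cdot\beta\vdash\Gamma$; $\Gamma\vdash\alpha$ and $\Delta\vdash\beta/\Gamma\odot\Delta\vdash\alpha\cdot\beta$; $\alpha\vdash\Gamma$ and $\beta\vdash\Delta/\alpha\sqcup\beta\vdash(\Gamma,\Delta)$; $\Gamma\vdash(\alpha,\beta)/\Gamma\vdash\alpha\sqcup\beta$; $(\alpha,\beta)\vdash\Gamma/\alpha\sqcap\beta\vdash\Gamma$; $\Gamma\vdash\alpha$ and $\Delta\vdash\beta/(\Gamma,\Delta)\vdash\alpha\sqcap\beta$. Logical modal: $\circ A\vdash X/\Diamond A\vdash X$; $X\vdash A/\circ X\vdash\Diamond A$; $\Gamma\vdash\alpha$ and $A\vdash X/\alpha\vartriangleright A\vdash\Gamma\hat{\vartriangleright}X$; $X\vdash\alpha\hat{\vartriangleright}A/X\vdash\alpha\vartriangleright A$; $\circ_r\alpha\vdash X/\Diamond_r\alpha\vdash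 X$; $\Gamma\vdash\alpha/\circ_r\Gamma\vdash\Diamond_r\alpha$; $\Gamma\vdash\alpha$ and $\beta\vdash\Delta/\alpha\vartriangleright_r\beta\vdash\Gamma\hat{\vartriangleright}_r\Delta$; $X\vdash\alpha\hat{\vartriangleright}_r\beta/X\vdash\alpha\vartriangleright_r\beta$. *)

(* Defs.v *)
From mathcomp Require Import all_boot.

Set Implicit Arguments.
Unset Strict Implicit.
Unset Printing Implicit Defensive.

Declare Scope lrc_scope.

(* The two sets of atoms are the types [P] (propositions) and [R] (resources);
   they are disjoint because they are separate types. *)

Inductive res (R : Type) : Type :=
| RAtom of R
| ROne
| RZero
| RDot of res R & res R
| RJoin of res R & res R
| RMeet of res R & res R.

Arguments ROne {R}.
Arguments RZero {R}.

Inductive fm (P R : Type) : Type :=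
| FAtom of P
| FTop
| FBot
| FOr of fm P R & fm P R
| FAnd of fm P R & fm P R
| FImp of fm P R & fm P R
| FBox of res R & fm P R
| FDia of fm P R
| FDiaR of res R
| FBoxR of res R & res R.

Arguments FAtom {P R}.
Arguments FTop {P R}.
Arguments FBot {P R}.
Arguments FDiaR {P R}.
Arguments FBoxR {P R}.

Notation "a ⋅ b" := (RDot a b) (at level 40, left associativity) : lrc_scope.
Notation "a ⊓ b" := (RMeet a b) (at level 40, left associativity) : lrc_scope.
Notation "a ⊔ b" := (RJoin a b) (at level 40, left associativity) : lrc_scope.

Notation "◇ A" := (FDia A) (at level 35, right associativity) : lrc_scope.
Notation "◇r a" := (FDiaR a) (at level 35, right associativity) : lrc_scope.
Notation "a ▷ A" := (FBox a A) (at level 50, left associativity) : lrc_scope.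
Notation "a ▷r b" := (FBoxR a b) (at level 50, left associativity)
  : lrc_scope.
Notation "A ∧ B" := (FAnd A B) (at level 60, right associativity) : lrc_scope.
Notation "A ∨ B" := (FOr A B) (at level 60, right associativity) : lrc_scope.
Notation "A → B" := (FImp A B) (at level 80, right associativity) : lrc_scope.
Notation "A ↔ B" := (FAnd (FImp A B) (FImp B A)) (at level 85, right associativity)
  : lrc_scope.

Local Open Scope lrc_scope.

Section Substitution.
Variables (P R : Type) (f : P -> fm P R) (g : R -> res R).

Fixpoint rsubst (a : res R) : res R :=
  match a with
  | RAtom r => g r
  | ROne => ROne
  | RZero => RZero
  | a1 ⋅ a2 => rsubst a1 ⋅ rsubst a2
  | a1 ⊔ a2 => rsubst a1 ⊔ rsubst a2
  | a1 ⊓ a2 => rsubst a1 ⊓ rsubst a2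
  end.

Fixpoint fsubst (A : fm P R) : fm P R :=
  match A with
  | FAtom p => f p
  | FTop => FTop
  | FBot => FBot
  | FOr A1 A2 => fsubst A1 ∨ fsubst A2
  | FAnd A1 A2 => fsubst A1 ∧ fsubst A2
  | FImp A1 A2 => fsubst A1 → fsubst A2
  | FBox a A1 => rsubst a ▷ fsubst A1
  | FDia A1 => ◇ fsubst A1
  | FDiaR a => ◇r rsubst a
  | FBoxR a b => rsubst a ▷r rsubst b
  end.

End Substitution.

Reserved Notation "a ⊢R b" (at level 70, no associativity).

(* Of each distributive law only the inequality that does not already hold in
   every lattice is listed. *)
Inductive rentails (R : Type) : res R -> res R -> Prop :=
| re_refl a : a ⊢R a
| re_trans a b c : a ⊢R b -> b ⊢R c -> a ⊢R c
| re_joinl a b : a ⊢R a ⊔ b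
| re_joinr a b : b ⊢R a ⊔ b
| re_join a b c : a ⊢R c -> b ⊢R c -> a ⊔ b ⊢R c
| re_meetl a b : a ⊓ b ⊢R a
| re_meetr a b : a ⊓ b ⊢R b
| re_meet a b c : c ⊢R a -> c ⊢R b -> c ⊢R a ⊓ b
| re_meet_join a b c : a ⊓ (b ⊔ c) ⊢R (a ⊓ b) ⊔ (a ⊓ c)
| re_join_meet a b c : (a ⊔ b) ⊓ (a ⊔ c) ⊢R a ⊔ (b ⊓ c)
| re_dotA1 a b c : a ⋅ (b ⋅ c) ⊢R (a ⋅ b) ⋅ c
| re_dotA2 a b c : (a ⋅ b) ⋅ c ⊢R a ⋅ (b ⋅ c)
| re_dot1l1 a : ROne ⋅ a ⊢R a
| re_dot1l2 a : a ⊢R ROne ⋅ a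
| re_dot1r1 a : a ⋅ ROne ⊢R a
| re_dot1r2 a : a ⊢R a ⋅ ROne
| re_one a : a ⊢R ROne
| re_zero a : RZero ⊢R a
| re_dot_joinr a b c : a ⋅ (b ⊔ c) ⊢R (a ⋅ b) ⊔ (a ⋅ c)
| re_dot_joinl a b c : (b ⊔ c) ⋅ a ⊢R (b ⋅ a) ⊔ (c ⋅ a)
| re_MF a b c : a ⊢R b -> a ⋅ c ⊢R b ⋅ c
| re_MF' a b c : a ⊢R b -> c ⋅ a ⊢R c ⋅ b
where "a ⊢R b" := (rentails a b) : lrc_scope.

Inductive lrc_thm (P R : Type) : fm P R -> Prop :=
| ipc_K A B : lrc_thm (A → B → A)
| ipc_S A B C : lrc_thm ((A → B → C) → (A → B) → A → C)
| ipc_andl A B : lrc_thm (A ∧ B → A)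
| ipc_andr A B : lrc_thm (A ∧ B → B)
| ipc_and A B : lrc_thm (A → B → A ∧ B)
| ipc_orl A B : lrc_thm (A → A ∨ B)
| ipc_orr A B : lrc_thm (B → A ∨ B)
| ipc_or A B C : lrc_thm ((A → C) → (B → C) → A ∨ B → C)
| ipc_bot A : lrc_thm (FBot → A)
| ipc_top : lrc_thm FTop
| lrc_D1 A B : lrc_thm (◇ (A ∨ B) ↔ ◇ A ∨ ◇ B)
| lrc_D2 : lrc_thm (◇ FBot ↔ FBot)
| lrc_D3 a b : lrc_thm (◇r (a ⊔ b) ↔ ◇r a ∨ ◇r b)
| lrc_D4 : lrc_thm (◇r RZero ↔ FBot)
| lrc_B1 a b A : lrc_thm ((a ⊔ b) ▷ A ↔ a ▷ A ∧ b ▷ A)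
| lrc_B2 A : lrc_thm (RZero ▷ A)
| lrc_B3 a b A : lrc_thm (a ▷ (b ▷ A) → (a ⋅ b) ▷ A)
| lrc_B4 a b c : lrc_thm ((a ⊔ b) ▷r c ↔ a ▷r c ∧ b ▷r c)
| lrc_B5 a : lrc_thm (RZero ▷r a)
| lrc_B6 a b c : lrc_thm (a ▷r (b ⊓ c) ↔ a ▷r b ∧ a ▷r c)
| lrc_B7 a : lrc_thm (a ▷r ROne)
| lrc_BD1 a A : lrc_thm (◇r a ∧ a ▷ A → ◇ A)
| lrc_BD2 a b : lrc_thm (a ▷r b → a ▷ ◇r b)
| lrc_MP A B : lrc_thm (A → B) -> lrc_thm A -> lrc_thm B
| lrc_subst (f : P -> fm P R) (g : R -> res R) A :
    lrc_thm A -> lrc_thm (fsubst f g A)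
| lrc_MB a A B : lrc_thm (A → B) -> lrc_thm (a ▷ A → a ▷ B)
| lrc_MD A B : lrc_thm (A → B) -> lrc_thm (◇ A → ◇ B)
| lrc_AB a b A : a ⊢R b -> lrc_thm (b ▷ A → a ▷ A)
| lrc_MD' a b : a ⊢R b -> lrc_thm (◇r a → ◇r b)
| lrc_MB' a b c : a ⊢R b -> lrc_thm (c ▷r a → c ▷r b)
| lrc_AB' a b c : a ⊢R b -> lrc_thm (b ▷r c → a ▷r c).

Definition lrc_entails (P R : Type) (A B : fm P R) : Prop := lrc_thm (A → B).

Inductive ty : Type := Fm | Rs.
Inductive pos : Type := Ant | Suc.

Definition opp (p : pos) : pos := if p is Ant then Suc else Ant.

(* [str P R t p] is the type of structures of type [t] in position [p].
   The residuals [SGt], [SLt], [SRGt] and [SRLt] exist in both positions; they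
   reverse the position of their left, right, left and right argument,
   respectively. *)
Inductive str (P R : Type) : ty -> pos -> Type :=
| Fml p of fm P R : str P R Fm p
| SI p : str P R Fm p
| SSemi p of str P R Fm p & str P R Fm p : str P R Fm p
| SGt p of str P R Fm (opp p) & str P R Fm p : str P R Fm p
| SLt p of str P R Fm p & str P R Fm (opp p) : str P R Fm p
| SCirc of str P R Fm Ant : str P R Fm Ant
| SCircR of str P R Rs Ant : str P R Fm Ant
| SBul of str P R Fm Suc : str P R Fm Suc
| SBox of str P R Rs Ant & str P R Fm Suc : str P R Fm Suc
| SBoxR of str P R Rs Ant & str P R Rs Suc : str P R Fm Suc
| Trm p of res R : str P R Rs p
| SPhi p : str P R Rs p
| SComma p of str P R Rs p & str P R Rs p : str P R Rs p
| SRGt p of str P R Rs (opp p) & str P R Rs p : str P R Rs p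
| SRLt p of str P R Rs p & str P R Rs (opp p) : str P R Rs p
| SDot of str P R Rs Ant & str P R Rs Ant : str P R Rs Ant
| SBTriR of str P R Rs Ant & str P R Fm Ant : str P R Rs Ant
| SDotGt of str P R Rs Ant & str P R Rs Suc : str P R Rs Suc
| SDotLt of str P R Rs Suc & str P R Rs Ant : str P R Rs Suc
| SBulR of str P R Fm Suc : str P R Rs Suc
| SBBox of str P R Fm Ant & str P R Fm Suc : str P R Rs Suc
| SBBoxR of str P R Fm Ant & str P R Rs Suc : str P R Rs Suc.

Arguments Fml {P R p} A.
Arguments SI {P R p}.
Arguments SGt {P R p} & X Y.
Arguments SLt {P R p} & X Y.
Arguments Trm {P R p} a.
Arguments SPhi {P R p}.
Arguments SRGt {P R p} & X Y.
Arguments SRLt {P R p} & X Y.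

Notation "X ⨟ Y" := (SSemi X Y) (at level 60, right associativity) : lrc_scope.
Notation "X ≻ Y" := (SGt X Y) (at level 60, right associativity) : lrc_scope.
Notation "X ≺ Y" := (SLt X Y) (at level 60, right associativity) : lrc_scope.
Notation "∘ X" := (SCirc X) (at level 35, right associativity) : lrc_scope.
Notation "∘r X" := (SCircR X) (at level 35, right associativity) : lrc_scope.
Notation "● X" := (SBul X) (at level 35, right associativity) : lrc_scope.
Notation "●r X" := (SBulR X) (at level 35, right associativity) : lrc_scope.
Notation "X ▷^ Y" := (SBox X Y) (at level 60, right associativity) : lrc_scope.
Notation "X ▷^r Y" := (SBoxR X Y) (at level 60, right associativity) : lrc_scope.
Notation "X ▶^ Y" := (SBBox X Y) (at level 60, right associativity) : lrc_scope.
Notation "X ▶^r Y" := (SBBoxR X Y) (at level 60, right associativity) : lrc_scope.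
Notation "X ▲^r Y" := (SBTriR X Y) (at level 60, right associativity) : lrc_scope.
Notation "X ,, Y" := (SComma X Y) (at level 60, right associativity) : lrc_scope.
Notation "X ⊐ Y" := (SRGt X Y) (at level 60, right associativity) : lrc_scope.
Notation "X ⊏ Y" := (SRLt X Y) (at level 60, right associativity) : lrc_scope.
Notation "X ⊙ Y" := (SDot X Y) (at level 60, right associativity) : lrc_scope.
Notation "X ⋗ Y" := (SDotGt X Y) (at level 60, right associativity) : lrc_scope.
Notation "X ⋖ Y" := (SDotLt X Y) (at level 60, right associativity) : lrc_scope.

(* [repl A Z S S']: the structure [S'] results from [S] by replacing exactly
   one occurrence of the formula [A], as a substructure in succedent position,
   by [Z]. *)
Inductive repl (P R : Type) (A : fm P R) (Z : str P R Fm Suc) :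
  forall t p, str P R t p -> str P R t p -> Prop :=
| repl_here : repl A Z (@Fml P R Suc A) Z
| repl_semil p (X X' Y : str P R Fm p) :
    repl A Z X X' -> repl A Z (X ⨟ Y) (X' ⨟ Y)
| repl_semir p (X Y Y' : str P R Fm p) :
    repl A Z Y Y' -> repl A Z (X ⨟ Y) (X ⨟ Y')
| repl_gtl p (X X' : str P R Fm (opp p)) (Y : str P R Fm p) :
    repl A Z X X' -> repl A Z (X ≻ Y) (X' ≻ Y)
| repl_gtr p (X : str P R Fm (opp p)) (Y Y' : str P R Fm p) :
    repl A Z Y Y' -> repl A Z (X ≻ Y) (X ≻ Y')
| repl_ltl p (X X' : str P R Fm p) (Y : str P R Fm (opp p)) :
    repl A Z X X' -> repl A Z (X ≺ Y) (X' ≺ Y)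
| repl_ltr p (X : str P R Fm p) (Y Y' : str P R Fm (opp p)) :
    repl A Z Y Y' -> repl A Z (X ≺ Y) (X ≺ Y')
| repl_circ X X' : repl A Z X X' -> repl A Z (∘ X) (∘ X')
| repl_circR X X' : repl A Z X X' -> repl A Z (∘r X) (∘r X')
| repl_bul X X' : repl A Z X X' -> repl A Z (● X) (● X')
| repl_boxl X X' Y : repl A Z X X' -> repl A Z (X ▷^ Y) (X' ▷^ Y)
| repl_boxr X Y Y' : repl A Z Y Y' -> repl A Z (X ▷^ Y) (X ▷^ Y')
| repl_boxRl X X' Y : repl A Z X X' -> repl A Z (X ▷^r Y) (X' ▷^r Y)
| repl_boxRr X Y Y' : repl A Z Y Y' -> repl A Z (X ▷^r Y) (X ▷^r Y')
| repl_commal p (X X' Y : str P R Rs p) :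
    repl A Z X X' -> repl A Z (X ,, Y) (X' ,, Y)
| repl_commar p (X Y Y' : str P R Rs p) :
    repl A Z Y Y' -> repl A Z (X ,, Y) (X ,, Y')
| repl_Rgtl p (X X' : str P R Rs (opp p)) (Y : str P R Rs p) :
    repl A Z X X' -> repl A Z (X ⊐ Y) (X' ⊐ Y)
| repl_Rgtr p (X : str P R Rs (opp p)) (Y Y' : str P R Rs p) :
    repl A Z Y Y' -> repl A Z (X ⊐ Y) (X ⊐ Y')
| repl_Rltl p (X X' : str P R Rs p) (Y : str P R Rs (opp p)) :
    repl A Z X X' -> repl A Z (X ⊏ Y) (X' ⊏ Y)
| repl_Rltr p (X : str P R Rs p) (Y Y' : str P R Rs (opp p)) :
    repl A Z Y Y' -> repl A Z (X ⊏ Y) (X ⊏ Y')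
| repl_dotl X X' Y : repl A Z X X' -> repl A Z (X ⊙ Y) (X' ⊙ Y)
| repl_dotr X Y Y' : repl A Z Y Y' -> repl A Z (X ⊙ Y) (X ⊙ Y')
| repl_btriRl X X' Y : repl A Z X X' -> repl A Z (X ▲^r Y) (X' ▲^r Y)
| repl_btriRr X Y Y' : repl A Z Y Y' -> repl A Z (X ▲^r Y) (X ▲^r Y')
| repl_dotgtl X X' Y : repl A Z X X' -> repl A Z (X ⋗ Y) (X' ⋗ Y)
| repl_dotgtr X Y Y' : repl A Z Y Y' -> repl A Z (X ⋗ Y) (X ⋗ Y')
| repl_dotltl X X' Y : repl A Z X X' -> repl A Z (X ⋖ Y) (X' ⋖ Y)
| repl_dotltr X Y Y' : repl A Z Y Y' -> repl A Z (X ⋖ Y) (X ⋖ Y')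
| repl_bulR X X' : repl A Z X X' -> repl A Z (●r X) (●r X')
| repl_bboxl X X' Y : repl A Z X X' -> repl A Z (X ▶^ Y) (X' ▶^ Y)
| repl_bboxr X Y Y' : repl A Z Y Y' -> repl A Z (X ▶^ Y) (X ▶^ Y')
| repl_bboxRl X X' Y : repl A Z X X' -> repl A Z (X ▶^r Y) (X' ▶^r Y)
| repl_bboxRr X Y Y' : repl A Z Y Y' -> repl A Z (X ▶^r Y) (X ▶^r Y').

Reserved Notation "X ⊢ Y" (at level 70, no associativity).

(* For an invertible rule [foo], [foo_d] is the downward and [foo_u] the
   upward direction. *)
Inductive dlrc (P R : Type) :
  forall t : ty, str P R t Ant -> str P R t Suc -> Prop :=
| d_idP (p : P) : Fml (FAtom p) ⊢ Fml (FAtom p)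
| d_idR (r : R) : Trm (RAtom r) ⊢ Trm (RAtom r)
| d_cut_ant (X X' : str P R Fm Ant) (Y Z : str P R Fm Suc) A :
    X ⊢ Y -> Fml A ⊢ Z -> repl A Z X X' -> X' ⊢ Y
| d_cut_suc (X : str P R Fm Ant) (Y Y' Z : str P R Fm Suc) A :
    X ⊢ Y -> Fml A ⊢ Z -> repl A Z Y Y' -> X ⊢ Y'
| d_cutR G a D : G ⊢ Trm a -> Trm a ⊢ D -> G ⊢ D
| d_semi_gt_d X Y Z : X ⨟ Y ⊢ Z -> Y ⊢ X ≻ Z
| d_semi_gt_u X Y Z : Y ⊢ X ≻ Z -> X ⨟ Y ⊢ Z
| d_gt_semi_d X Y Z : Z ⊢ X ⨟ Y -> X ≻ Z ⊢ Y
| d_gt_semi_u X Y Z : X ≻ Z ⊢ Y -> Z ⊢ X ⨟ Y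
| d_semi_lt_d X Y Z : X ⨟ Y ⊢ Z -> X ⊢ Z ≺ Y
| d_semi_lt_u X Y Z : X ⊢ Z ≺ Y -> X ⨟ Y ⊢ Z
| d_lt_semi_d X Y Z : Z ⊢ X ⨟ Y -> Z ≺ Y ⊢ X
| d_lt_semi_u X Y Z : Z ≺ Y ⊢ X -> Z ⊢ X ⨟ Y
| d_comma_gt_d G D S : G ,, D ⊢ S -> D ⊢ G ⊐ S
| d_comma_gt_u G D S : D ⊢ G ⊐ S -> G ,, D ⊢ S
| d_comma_lt_d G D S : G ,, D ⊢ S -> G ⊢ S ⊏ D
| d_comma_lt_u G D S : G ⊢ S ⊏ D -> G ,, D ⊢ S
| d_gt_comma_d G D S : G ⊢ D ,, S -> D ⊐ G ⊢ S
| d_gt_comma_u G D S : D ⊐ G ⊢ S -> G ⊢ D ,, S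
| d_lt_comma_d G D S : G ⊢ D ,, S -> G ⊏ S ⊢ D
| d_lt_comma_u G D S : G ⊏ S ⊢ D -> G ⊢ D ,, S
| d_dot_gt_d G D S : G ⊙ D ⊢ S -> D ⊢ G ⋗ S
| d_dot_gt_u G D S : D ⊢ G ⋗ S -> G ⊙ D ⊢ S
| d_dot_lt_d G D S : G ⊙ D ⊢ S -> G ⊢ S ⋖ D
| d_dot_lt_u G D S : G ⊢ S ⋖ D -> G ⊙ D ⊢ S
| d_circ_bul_d X Y : ∘ X ⊢ Y -> X ⊢ ● Y
| d_circ_bul_u X Y : X ⊢ ● Y -> ∘ X ⊢ Y
| d_circR_bulR_d G X : ∘r G ⊢ X -> G ⊢ ●r X
| d_circR_bulR_u G X : G ⊢ ●r X -> ∘r G ⊢ X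
| d_box_bbox_d X G Y : X ⊢ G ▷^ Y -> G ⊢ X ▶^ Y
| d_box_bbox_u X G Y : G ⊢ X ▶^ Y -> X ⊢ G ▷^ Y
| d_boxR_btriR_d X G D : X ⊢ G ▷^r D -> G ▲^r X ⊢ D
| d_boxR_btriR_u X G D : G ▲^r X ⊢ D -> X ⊢ G ▷^r D
| d_boxR_bboxR_d X G D : X ⊢ G ▷^r D -> G ⊢ X ▶^r D
| d_boxR_bboxR_u X G D : G ⊢ X ▶^r D -> X ⊢ G ▷^r D
| d_Il_d X Y : X ⊢ Y -> SI ⨟ X ⊢ Y
| d_Il_u X Y : SI ⨟ X ⊢ Y -> X ⊢ Y
| d_Ir_d Y X : Y ⊢ X -> Y ⊢ X ⨟ SI
| d_Ir_u Y X : Y ⊢ X ⨟ SI -> Y ⊢ X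
| d_El X Y Z : Y ⨟ X ⊢ Z -> X ⨟ Y ⊢ Z
| d_Er X Y Z : Z ⊢ X ⨟ Y -> Z ⊢ Y ⨟ X
| d_Wl X Y Z : Y ⊢ Z -> X ⨟ Y ⊢ Z
| d_Wr X Y Z : Z ⊢ Y -> Z ⊢ Y ⨟ X
| d_Cl X Y : X ⨟ X ⊢ Y -> X ⊢ Y
| d_Cr X Y : Y ⊢ X ⨟ X -> Y ⊢ X
| d_Al_d X Y Z W : X ⨟ (Y ⨟ Z) ⊢ W -> (X ⨟ Y) ⨟ Z ⊢ W
| d_Al_u X Y Z W : (X ⨟ Y) ⨟ Z ⊢ W -> X ⨟ (Y ⨟ Z) ⊢ W
| d_Ar_d X Y Z W : W ⊢ (Z ⨟ Y) ⨟ X -> W ⊢ Z ⨟ (Y ⨟ X)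
| d_Ar_u X Y Z W : W ⊢ Z ⨟ (Y ⨟ X) -> W ⊢ (Z ⨟ Y) ⨟ X
| d_dotPhir_d G D : G ⊙ SPhi ⊢ D -> G ⊢ D
| d_dotPhir_u G D : G ⊢ D -> G ⊙ SPhi ⊢ D
| d_dotPhil_d G D : G ⊢ D -> SPhi ⊙ G ⊢ D
| d_dotPhil_u G D : SPhi ⊙ G ⊢ D -> G ⊢ D
| d_commaPhi_d G D : G ⊢ D -> G ⊢ D ,, SPhi
| d_commaPhi_u G D : G ⊢ D ,, SPhi -> G ⊢ D
| d_dotA_d G D S Q : G ⊙ (D ⊙ S) ⊢ Q -> (G ⊙ D) ⊙ S ⊢ Q
| d_dotA_u G D S Q : (G ⊙ D) ⊙ S ⊢ Q -> G ⊙ (D ⊙ S) ⊢ Q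
| d_PhiW G D : SPhi ⊢ D -> G ⊢ D
| d_RWl G D S : G ⊢ D -> G ,, S ⊢ D
| d_RWr G D S : G ⊢ D -> G ⊢ D ,, S
| d_RCl G D : G ,, G ⊢ D -> G ⊢ D
| d_RCr G D : G ⊢ D ,, D -> G ⊢ D
| d_REl G D S : G ,, D ⊢ S -> D ,, G ⊢ S
| d_REr G D S : S ⊢ G ,, D -> S ⊢ D ,, G
| d_RAl_d G D S Q : S ,, (D ,, G) ⊢ Q -> (S ,, D) ,, G ⊢ Q
| d_RAl_u G D S Q : (S ,, D) ,, G ⊢ Q -> S ,, (D ,, G) ⊢ Q
| d_RAr_d G D S Q : Q ⊢ S ,, (D ,, G) -> Q ⊢ (S ,, D) ,, G
| d_RAr_u G D S Q : Q ⊢ (S ,, D) ,, G -> Q ⊢ S ,, (D ,, G)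
| d_dotgt_comma G D S Q : Q ⊢ (G ⋗ D) ,, (G ⋗ S) -> Q ⊢ G ⋗ (D ,, S)
| d_bul_semi X Y Z : X ⊢ (● Y) ⨟ (● Z) -> X ⊢ ● (Y ⨟ Z)
| d_bulR_semi G X Y : G ⊢ (●r X) ,, (●r Y) -> G ⊢ ●r (X ⨟ Y)
| d_bul_I X : X ⊢ SI -> X ⊢ ● SI
| d_bulR_I G : G ⊢ SPhi -> G ⊢ ●r SI
| d_bboxR_semi G Y Z D :
    G ⊢ (Y ▶^r D) ,, (Z ▶^r D) -> G ⊢ (Y ⨟ Z) ▶^r D
| d_bbox_semi G Y Z W :
    G ⊢ (Y ▶^ W) ,, (Z ▶^ W) -> G ⊢ (Y ⨟ Z) ▶^ W
| d_btriR_semi G X Y D :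
    (G ▲^r X) ,, (G ▲^r Y) ⊢ D -> G ▲^r (X ⨟ Y) ⊢ D
| d_box_dot X G D Y : X ⊢ G ▷^ (D ▷^ Y) -> X ⊢ (G ⊙ D) ▷^ Y
| d_btriR_I G D : SPhi ⊢ D -> G ▲^r SI ⊢ D
| d_BD1 X G Y : X ⊢ G ▷^ (● Y) -> X ⊢ (∘r G) ≻ Y
| d_BD2 X G Y : X ⊢ G ▷^r (●r Y) -> X ⊢ G ▷^ Y
| d_bot_l : Fml FBot ⊢ SI
| d_bot_r X : X ⊢ SI -> X ⊢ Fml FBot
| d_top_l X : SI ⊢ X -> Fml FTop ⊢ X
| d_top_r : SI ⊢ Fml FTop
| d_and_l A B X : Fml A ⨟ Fml B ⊢ X -> Fml (A ∧ B) ⊢ X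
| d_and_r A B X Y : X ⊢ Fml A -> Y ⊢ Fml B -> X ⨟ Y ⊢ Fml (A ∧ B)
| d_or_l A B X Y : Fml A ⊢ X -> Fml B ⊢ Y -> Fml (A ∨ B) ⊢ X ⨟ Y
| d_or_r A B X : X ⊢ Fml A ⨟ Fml B -> X ⊢ Fml (A ∨ B)
| d_imp_l A B X Y : X ⊢ Fml A -> Fml B ⊢ Y -> Fml (A → B) ⊢ X ≻ Y
| d_imp_r A B X : X ⊢ Fml A ≻ Fml B -> X ⊢ Fml (A → B)
| d_zero_l : Trm RZero ⊢ SPhi
| d_zero_r G : G ⊢ SPhi -> G ⊢ Trm RZero
| d_one_l G : SPhi ⊢ G -> Trm ROne ⊢ G
| d_one_r : SPhi ⊢ Trm ROne
| d_dot_l a b G : Trm a ⊙ Trm b ⊢ G -> Trm (a ⋅ b) ⊢ G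
| d_dot_r a b G D : G ⊢ Trm a -> D ⊢ Trm b -> G ⊙ D ⊢ Trm (a ⋅ b)
| d_join_l a b G D : Trm a ⊢ G -> Trm b ⊢ D -> Trm (a ⊔ b) ⊢ G ,, D
| d_join_r a b G : G ⊢ Trm a ,, Trm b -> G ⊢ Trm (a ⊔ b)
| d_meet_l a b G : Trm a ,, Trm b ⊢ G -> Trm (a ⊓ b) ⊢ G
| d_meet_r a b G D : G ⊢ Trm a -> D ⊢ Trm b -> G ,, D ⊢ Trm (a ⊓ b)
| d_dia_l A X : ∘ (Fml A) ⊢ X -> Fml (◇ A) ⊢ X
| d_dia_r A X : X ⊢ Fml A -> ∘ X ⊢ Fml (◇ A)
| d_box_l a A G X : G ⊢ Trm a -> Fml A ⊢ X -> Fml (a ▷ A) ⊢ G ▷^ X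
| d_box_r a A X : X ⊢ Trm a ▷^ Fml A -> X ⊢ Fml (a ▷ A)
| d_diaR_l a X : ∘r (Trm a) ⊢ X -> Fml (◇r a) ⊢ X
| d_diaR_r a G : G ⊢ Trm a -> ∘r G ⊢ Fml (◇r a)
| d_boxR_l a b G D : G ⊢ Trm a -> Trm b ⊢ D -> Fml (a ▷r b) ⊢ G ▷^r D
| d_boxR_r a b X : X ⊢ Trm a ▷^r Trm b -> X ⊢ Fml (a ▷r b)
where "X ⊢ Y" := (dlrc X Y) : lrc_scope.

(* Main.v *)
Require Import Defs.
From mathcomp Require Import all_boot.

Set Implicit Arguments.
Unset Strict Implicit.
Unset Printing Implicit Defensive.

Local Open Scope lrc_scope.

(** Antecedent structures are interpreted as filters, and succedent structures
    as ideals, of the Lindenbaum algebra of H.LRC; these are the closed and the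
    open elements of its canonical extension.  A sequent is valid when the
    filter meets the ideal, that is, when it has an interpolant in the language
    of H.LRC.  The positions in which a structural connective may occur are
    exactly those in which it sends filters and ideals to a filter or an ideal,
    although its algebraic counterpart need not exist in the Lindenbaum algebra,
    and the residuation equivalences behind the display rules hold on the nose.
    For a sequent [A ⊢ B] between formulas an interpolant [C] gives [A → C] and
    [C → B]. *)

(** * Lattice laws, residuation and monotonicity derived in H.LRC *)

Section Lindenbaum.
Context {P R : Type}.
Implicit Types (A B C D : fm P R) (a b c : res R).

Local Notation "A ≤ B" := (@lrc_entails P R A B) (at level 90).

(** [thm_K] and [thm_S] do the work of the deduction theorem: weakening, and modus ponens under a
    common hypothesis. *)
Lemma thm_K A B : lrc_thm A -> B ≤ A.
Proof. by apply: lrc_MP; apply: ipc_K. Qed.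

Lemma thm_S A B C : A ≤ (B → C) -> A ≤ B -> A ≤ C.
Proof. by move=> h; apply: lrc_MP; move: h; apply: lrc_MP; apply: ipc_S. Qed.

Lemma le_refl A : A ≤ A.
Proof. by apply: (@thm_S A (A → A)); apply: ipc_K. Qed.

Lemma le_trans A B C : A ≤ B -> B ≤ C -> A ≤ C.
Proof. by move=> hAB hBC; apply: thm_S hAB; apply: thm_K. Qed.

Lemma le_and A B C : C ≤ A -> C ≤ B -> C ≤ (A ∧ B).
Proof. by move=> hA; apply: thm_S; apply: le_trans hA _; apply: ipc_and. Qed.

Lemma le_or A B C : A ≤ C -> B ≤ C -> (A ∨ B) ≤ C.
Proof. by move=> hA; apply: lrc_MP; move: hA; apply: lrc_MP; apply: ipc_or. Qed.

Lemma le_imp A B C : (A ∧ B) ≤ C <-> B ≤ (A → C).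
Proof.
split=> h.
  (* Under the hypothesis [B], pairing gives [A → A ∧ B], and [h] is then composed with it behind
     the common premise [A]. *)
  apply: (@thm_S _ (A → A ∧ B)); last first.
    apply: (@le_trans _ (A → B)); first exact: ipc_K.
    apply: lrc_MP (ipc_S _ _ _) _.
    exact: ipc_and.
  by apply: thm_K; apply: lrc_MP (ipc_S _ _ _) _; apply: thm_K.
by apply: thm_S (ipc_andl _ _); apply: le_trans (ipc_andr _ _) h.
Qed.

Lemma thm_iff A B : lrc_thm (A ↔ B) -> (A ≤ B) /\ (B ≤ A).
Proof.
by move=> h; split; move: h; apply: lrc_MP; [apply: ipc_andl | apply: ipc_andr].
Qed.

(** By [le_imp], conjunction with [A] is a left adjoint, so it preserves disjunctions. *)
Lemma le_and_or A B C : (A ∧ (B ∨ C)) ≤ ((A ∧ B) ∨ (A ∧ C)).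
Proof.
apply/le_imp; apply: le_or; apply/le_imp; [exact: ipc_orl | exact: ipc_orr].
Qed.

(** Two applications of [le_and_or], one for each disjunction on the left; every summand except
    [B ∧ C] is absorbed by [A]. *)
Lemma le_or_and A B C : ((A ∨ B) ∧ (A ∨ C)) ≤ (A ∨ (B ∧ C)).
Proof.
apply: le_trans (le_and_or _ _ _) _; apply: le_or.
  exact: le_trans (ipc_andr _ _) (ipc_orl _ _).
apply: (@le_trans _ (C ∧ (A ∨ B))).
  by apply: le_and; [apply: ipc_andr | apply: ipc_andl].
apply: le_trans (le_and_or _ _ _) _; apply: le_or.
  exact: le_trans (ipc_andr _ _) (ipc_orl _ _).
apply: le_trans (ipc_orr _ _).
by apply: le_and; [apply: ipc_andr | apply: ipc_andl].
Qed.

Lemma le_dia_or A B : ◇ (A ∨ B) ≤ (◇ A ∨ ◇ B).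
Proof. by case: (thm_iff (lrc_D1 A B)). Qed.

Lemma le_diaR_join a b : @FDiaR P R (a ⊔ b) ≤ (◇r a ∨ ◇r b).
Proof. by case: (thm_iff (lrc_D3 P a b)). Qed.

Lemma le_box a b A B : b ⊢R a -> A ≤ B -> (a ▷ A) ≤ (b ▷ B).
Proof. by move=> hba hAB; apply: le_trans (lrc_MB _ hAB); apply: lrc_AB. Qed.

Lemma le_boxR a b c d : b ⊢R a -> c ⊢R d -> @FBoxR P R a c ≤ (b ▷r d).
Proof. by move=> hba hcd; apply: le_trans (lrc_MB' _ _ hcd); apply: lrc_AB'. Qed.

(** Both boxes are weakened to the common right argument [A ∨ B], and B1 then merges the left
    arguments. This makes the interpretation of [▶^] closed under joins. *)
Lemma le_and_box a b A B : (a ▷ A ∧ b ▷ B) ≤ ((a ⊔ b) ▷ (A ∨ B)).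
Proof.
have [_ h] := thm_iff (lrc_B1 a b (A ∨ B)); apply: le_trans h; apply: le_and.
  apply: le_trans (ipc_andl _ _) _; apply: lrc_MB; exact: ipc_orl.
apply: le_trans (ipc_andr _ _) _; apply: lrc_MB; exact: ipc_orr.
Qed.

Lemma le_and_boxR_join a b c d :
  @FBoxR P R a c ∧ b ▷r d ≤ ((a ⊔ b) ▷r (c ⊔ d)).
Proof.
have [_ h] := thm_iff (lrc_B4 P a b (c ⊔ d)); apply: le_trans h; apply: le_and.
  apply: le_trans (ipc_andl _ _) _; apply: lrc_MB'; exact: re_joinl.
apply: le_trans (ipc_andr _ _) _; apply: lrc_MB'; exact: re_joinr.
Qed.

(** Here the left arguments are made equal first, and B6 merges the right ones. This makes the
    interpretation of [▲^r] closed under meets. *)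
Lemma le_and_boxR_meet a b c d :
  @FBoxR P R a c ∧ b ▷r d ≤ ((a ⊓ b) ▷r (c ⊓ d)).
Proof.
have [_ h] := thm_iff (lrc_B6 P (a ⊓ b) c d); apply: le_trans h; apply: le_and.
  apply: le_trans (ipc_andl _ _) _; apply: lrc_AB'; exact: re_meetl.
apply: le_trans (ipc_andr _ _) _; apply: lrc_AB'; exact: re_meetr.
Qed.

End Lindenbaum.

Lemma re_dot (R : Type) (a b c d : res R) :
  a ⊢R b -> c ⊢R d -> a ⋅ c ⊢R b ⋅ d.
Proof. by move=> hab hcd; apply: re_trans (re_MF _ hab) (re_MF' _ hcd). Qed.

(** * Formulas and resources as preordered lattices, up to duality *)

Section Cones.
Variables P R : Type.

(** No quotient is taken: the Lindenbaum algebra is represented by its preorder, and cones respect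
    mutual entailment because they are closed upwards. *)
Definition carrier (t : ty) : Type := if t is Fm then fm P R else res R.

Definition le (t : ty) : carrier t -> carrier t -> Prop :=
  match t with Fm => @lrc_entails P R | Rs => @rentails R end.

(* Position [Suc] carries the dual order, so that [op p] is always the meet and
   [unit p] always the top of [ple p], and ideals are the filters of
   [ple Suc]. *)
Definition ple (p : pos) t (x y : carrier t) : Prop :=
  match p with Ant => le x y | Suc => le y x end.

Definition op (p : pos) (t : ty) : carrier t -> carrier t -> carrier t :=
  match t, p with
  | Fm, Ant => @FAnd P R
  | Fm, Suc => @FOr P R
  | Rs, Ant => @RMeet R
  | Rs, Suc => @RJoin R
  end.

(** By R3 the neutral element [ROne] of [⋅] is also the top resource, hence the unit of [⊓]. *)
Definition unit (p : pos) (t : ty) : carrier t :=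
  match t, p with
  | Fm, Ant => FTop
  | Fm, Suc => FBot
  | Rs, Ant => ROne
  | Rs, Suc => RZero
  end.

Section Order.
Variables (p : pos) (t : ty).
Implicit Types x y z w : carrier t.

Lemma ple_refl x : ple p x x.
Proof. by case: p t x => [] [] x; (exact: le_refl || exact: re_refl). Qed.

Lemma ple_trans x y z : ple p x y -> ple p y z -> ple p x z.
Proof.
case: p t x y z => [] [] x y z /= h1 h2.
- exact: le_trans h1 h2.
- exact: re_trans h1 h2.
- exact: le_trans h2 h1.
- exact: re_trans h2 h1.
Qed.

Lemma ple_opl x y : ple p (op p x y) x.
Proof.
by case: p t x y => [] [] x y;
  [exact: ipc_andl | exact: re_meetl | exact: ipc_orl | exact: re_joinl].
Qed.

Lemma ple_opr x y : ple p (op p x y) y.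
Proof.
by case: p t x y => [] [] x y;
  [exact: ipc_andr | exact: re_meetr | exact: ipc_orr | exact: re_joinr].
Qed.

Lemma ple_op x y z : ple p z x -> ple p z y -> ple p z (op p x y).
Proof.
by case: p t x y z => [] [] x y z;
  [exact: le_and | exact: re_meet | exact: le_or | exact: re_join].
Qed.

Lemma ple_unit x : ple p x (unit p t).
Proof.
case: p t x => [] [] x;
  [exact: thm_K (ipc_top _ _) | exact: re_one | exact: ipc_bot | exact: re_zero].
Qed.

Lemma ple_op2 x y z w : ple p x z -> ple p y w -> ple p (op p x y) (op p z w).
Proof.
move=> hx hy; apply: ple_op; first exact: ple_trans (ple_opl _ _) hx.
exact: ple_trans (ple_opr _ _) hy.
Qed.

Lemma ple_opA x y z : ple p (op p x (op p y z)) (op p (op p x y) z).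
Proof.
apply: ple_op; first exact: ple_op2 (ple_refl _) (ple_opl _ _).
exact: ple_trans (ple_opr _ _) (ple_opr _ _).
Qed.

Lemma ple_opA' x y z : ple p (op p (op p x y) z) (op p x (op p y z)).
Proof.
apply: ple_op; first exact: ple_trans (ple_opl _ _) (ple_opl _ _).
exact: ple_op2 (ple_opr _ _) (ple_refl _).
Qed.

Lemma ple_op_distr x y z :
  ple p (op p (op (opp p) x y) (op (opp p) x z)) (op (opp p) x (op p y z)).
Proof.
by case: p t x y z => [] [] x y z;
  [exact: le_or_and | exact: re_join_meet | exact: le_and_or | exact: re_meet_join].
Qed.

Lemma ple_opp x y : ple (opp p) x y <-> ple p y x.
Proof. by case: p. Qed.

End Order.

(** * Filters and ideals, the cones they generate, and their residuals *)

Record cone (p : pos) t (U : carrier t -> Prop) : Prop := Cone {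
  cone_unit : U (unit p t);
  cone_up x y : ple p x y -> U x -> U y;
  cone_op x y : U x -> U y -> U (op p x y) }.

Definition set_op p t (U V : carrier t -> Prop) (z : carrier t) : Prop :=
  exists x y, [/\ U x, V y & ple p (op p x y) z].

(** For [p = Suc], the union of the ideals of all [z] with [x ∧ z] below [y], where [x] is in the
    filter [U] and [y] in the ideal [V]: an implication without implication elements. For [p = Ant]
    it is the dual co-implication. *)
Definition set_res p t (U V : carrier t -> Prop) (z : carrier t) : Prop :=
  exists x y, [/\ U x, V y & ple p y (op (opp p) x z)].

Definition overlap t (U V : carrier t -> Prop) : Prop := exists2 x, U x & V x.

Lemma ple_opp_op p t (x x' y y' : carrier t) :
  ple p x x' -> ple p y y' -> ple p (op (opp p) x y) (op (opp p) x' y').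
Proof. by move=> hx hy; apply/ple_opp/ple_op2; apply/ple_opp. Qed.

Lemma cone_ple p t (x : carrier t) : cone p (ple p x).
Proof.
split=> [|y z hyz hxy|y z]; first exact: ple_unit; last exact: ple_op.
exact: ple_trans hxy hyz.
Qed.

Lemma cone_set_op p t (U V : carrier t -> Prop) :
  cone p U -> cone p V -> cone p (set_op p U V).
Proof.
move=> hU hV; split.
- exists (unit p t), (unit p t); split; [exact: cone_unit hU | exact: cone_unit hV |].
  exact: ple_unit.
- move=> x y hxy [u [v [Uu Vv h]]]; exists u, v; split=> //.
  exact: ple_trans h hxy.
- move=> x y [u [v [Uu Vv h]]] [u' [v' [Uu' Vv' h']]].
  exists (op p u u'), (op p v v'); split.
  + exact: (cone_op hU).
  + exact: (cone_op hV).
  + apply: ple_op; [apply: ple_trans h | apply: ple_trans h']; apply: ple_op2;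
      by [apply: ple_opl | apply: ple_opr].
Qed.

(** Closure under [op p] rests on distributivity: for [p = Ant], if [u ∨ x] is above [v] and
    [u' ∨ y] above [v'], then [(u ∨ u') ∨ (x ∧ y)] is above [v ∧ v']. *)
Lemma cone_set_res p t (U V : carrier t -> Prop) :
  cone (opp p) U -> cone p V -> cone p (set_res p U V).
Proof.
move=> hU hV; split.
- exists (unit (opp p) t), (unit p t).
  split; [exact: cone_unit hU | exact: cone_unit hV |].
  by apply/ple_opp/ple_opr.
- move=> x y hxy [u [v [Uu Vv h]]]; exists u, v; split=> //.
  exact: ple_trans h (ple_opp_op (ple_refl _ _) hxy).
- move=> x y [u [v [Uu Vv h]]] [u' [v' [Uu' Vv' h']]].
  exists (op (opp p) u u'), (op p v v'); split.
  + exact: (cone_op hU).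
  + exact: (cone_op hV).
  + apply: ple_trans (ple_op_distr _ _ _ _).
    apply: ple_op2; [apply: ple_trans h _ | apply: ple_trans h' _];
      apply: ple_opp_op (ple_refl _ _); apply/ple_opp.
      exact: ple_opl.
    exact: ple_opr.
Qed.

Section SetOp.
Variables (p : pos) (t : ty).
Implicit Types U V W : carrier t -> Prop.

Lemma set_op_mono U U' V V' z : (forall x, U x -> U' x) ->
  (forall x, V x -> V' x) -> set_op p U V z -> set_op p U' V' z.
Proof. by move=> hU hV [x [y [/hU Ux /hV Vy h]]]; exists x, y. Qed.

Lemma set_res_mono U U' V V' z : (forall x, U x -> U' x) ->
  (forall x, V x -> V' x) -> set_res p U V z -> set_res p U' V' z.
Proof. by move=> hU hV [x [y [/hU Ux /hV Vy h]]]; exists x, y. Qed.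

(** With [set_opl] and [set_opr], this makes [set_op p U V] the least cone including two given
    cones. *)
Lemma set_op_sub U V W z : cone p W -> (forall x, U x -> W x) ->
  (forall x, V x -> W x) -> set_op p U V z -> W z.
Proof.
move=> hW hU hV [x [y [/hU Wx /hV Wy h]]].
exact: (cone_up hW h (cone_op hW Wx Wy)).
Qed.

Lemma set_opC U V z : set_op p U V z -> set_op p V U z.
Proof.
move=> [x [y [Ux Vy h]]]; exists y, x; split=> //.
by apply: ple_trans h; apply: ple_op; [apply: ple_opr | apply: ple_opl].
Qed.

Lemma set_opl U V z : cone p V -> U z -> set_op p U V z.
Proof.
move=> hV Uz; exists z, (unit p t); split=> //; first exact: cone_unit hV.
exact: ple_opl.
Qed.

Lemma set_opr U V z : cone p U -> V z -> set_op p U V z.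
Proof. by move=> hU Vz; apply: set_opC; apply: set_opl. Qed.

Lemma set_op_unit V z : cone p V -> set_op p (ple p (unit p t)) V z -> V z.
Proof.
move=> hV; apply: set_op_sub => // x h.
exact: (cone_up hV h (cone_unit hV)).
Qed.

Lemma set_op_idem U z : cone p U -> set_op p U U z -> U z.
Proof. by move=> hU; apply: set_op_sub. Qed.

Lemma set_opA U V W z :
  set_op p U (set_op p V W) z -> set_op p (set_op p U V) W z.
Proof.
move=> [x [y [Ux [v [w [Vv Ww h]]] h']]].
exists (op p x v), w; split=> //.
  by exists x, v; split=> //; apply: ple_refl.
apply: ple_trans (ple_opA' _ _ _ _) _.
exact: ple_trans (ple_op2 (ple_refl _ _) h) h'.
Qed.

Lemma set_opA' U V W z :
  set_op p (set_op p U V) W z -> set_op p U (set_op p V W) z.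
Proof.
move=> [x [y [[v [w [Uv Vw h]]] Wy h']]].
exists v, (op p w y); split=> //.
  by exists w, y; split=> //; apply: ple_refl.
apply: ple_trans (ple_opA _ _ _ _) _.
exact: ple_trans (ple_op2 h (ple_refl _ _)) h'.
Qed.

Lemma set_op_le U V x y : U x -> V y -> set_op p U V (op p x y).
Proof. by exists x, y; split=> //; apply: ple_refl. Qed.

End SetOp.

(** Both sides assert the same inequality between three elements; only the quantifiers are
    regrouped. *)
Lemma set_op_res p t (U V W : carrier t -> Prop) :
  overlap (set_op (opp p) U V) W <-> overlap V (set_res p U W).
Proof.
split=> [[z [x [y [Ux Vy h]]] Wz]|[z Vz [x [y [Ux Wy h]]]]].
  by exists y => //; exists x, z; split=> //; apply/ple_opp.
by exists y => //; exists x, z; split=> //; apply/ple_opp.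
Qed.

Lemma set_op_resC p t (U V W : carrier t -> Prop) :
  overlap (set_op (opp p) V U) W <-> overlap V (set_res p U W).
Proof.
split=> [[z UVz Wz]|/set_op_res[z UVz Wz]].
  by apply/set_op_res; exists z => //; apply: set_opC.
by exists z => //; apply: set_opC.
Qed.

Lemma overlapC t (U V : carrier t -> Prop) : overlap U V <-> overlap V U.
Proof. by split=> -[x]; exists x. Qed.

Lemma overlap_subl t (U U' V : carrier t -> Prop) :
  (forall x, U x -> U' x) -> overlap U V -> overlap U' V.
Proof. by move=> h [x /h Ux Vx]; exists x. Qed.

Lemma overlap_subr t (U V V' : carrier t -> Prop) :
  (forall x, V x -> V' x) -> overlap U V -> overlap U V'.
Proof. by move=> h [x Ux /h Vx]; exists x. Qed.

(** Turns validity of a sequent with a formula or resource term on one side into membership, the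
    form in which the logical rules are checked. *)
Lemma overlap_ple p t (x : carrier t) (V : carrier t -> Prop) :
  cone (opp p) V -> overlap (ple p x) V <-> V x.
Proof.
move=> hV; split=> [[y hxy Vy]|Vx]; last by exists x => //; apply: ple_refl.
by apply: (cone_up hV) Vy; apply/ple_opp.
Qed.

End Cones.

Arguments ple {P R} p {t} x y.
Arguments unit {P R} p t.

(** * Interpretation of structures as cones *)

Section Soundness.
Variables P R : Type.

(** [∘], [∘r], [⊙], [▷^] and [▷^r] generate a cone from the values of the connective. Their adjoints
    read the same inequality in another variable, so [▷^r], [▲^r] and [▶^r] share one ternary
    relation. *)
Fixpoint sem t p (S : str P R t p) : carrier P R t -> Prop :=
  match S with
  | @Fml _ _ p A => @ple P R p Fm A
  | SI p => @ple P R p Fm (unit p Fm)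
  | SSemi p X Y => @set_op P R p Fm (sem X) (sem Y)
  | @SGt _ _ p X Y => @set_res P R p Fm (sem X) (sem Y)
  | @SLt _ _ p X Y => @set_res P R p Fm (sem Y) (sem X)
  | ∘ X => fun C => exists2 D, sem X D & lrc_entails (◇ D) C
  | ∘r G => fun C => exists2 a, sem G a & lrc_entails (◇r a) C
  | ● Y => fun C => sem Y (◇ C)
  | G ▷^ Y => fun C =>
      exists a B, [/\ sem G a, sem Y B & lrc_entails C (a ▷ B)]
  | G ▷^r D => fun C =>
      exists a b, [/\ sem G a, sem D b & lrc_entails C (a ▷r b)]
  | @Trm _ _ p a => @ple P R p Rs a
  | SPhi p => @ple P R p Rs (unit p Rs)
  | SComma p G D => @set_op P R p Rs (sem G) (sem D)
  | @SRGt _ _ p G D => @set_res P R p Rs (sem G) (sem D)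
  | @SRLt _ _ p G D => @set_res P R p Rs (sem D) (sem G)
  | G ⊙ D => fun c => exists a b, [/\ sem G a, sem D b & a ⋅ b ⊢R c]
  | G ▲^r X => fun b =>
      exists a C, [/\ sem G a, sem X C & lrc_entails C (a ▷r b)]
  | G ⋗ D => fun b => exists2 a, sem G a & sem D (a ⋅ b)
  | D ⋖ G => fun b => exists2 a, sem G a & sem D (b ⋅ a)
  | ●r Y => fun a => sem Y (◇r a)
  | X ▶^ Y => fun a =>
      exists C B, [/\ sem X C, sem Y B & lrc_entails C (a ▷ B)]
  | X ▶^r D => fun a =>
      exists C b, [/\ sem X C, sem D b & lrc_entails C (a ▷r b)]
  end.

(** Generated cones need only monotonicity of the connective. The adjoints need it to preserve units
    and binary operations: D1 and D2 for [●], D3 and D4 for [●r], B1 and B2 for [▶^], B4 and B5 for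
    [▶^r], B6 and B7 for [▲^r], R4 for [⋗] and [⋖]. *)
Lemma cone_sem t p (S : str P R t p) : cone p (sem S).
Proof.
elim: S => {t p} /=.
- by move=> p A; apply: cone_ple.
- by move=> p; apply: cone_ple.
- by move=> p X hX Y hY; apply: cone_set_op.
- by move=> p X hX Y hY; apply: cone_set_res.
- by move=> p X hX Y hY; apply: cone_set_res.
- move=> X hX; split.
  + by exists FTop; [exact: cone_unit hX | exact: thm_K (ipc_top _ _)].
  + by move=> A B hAB [D XD h]; exists D => //; apply: le_trans h hAB.
  + move=> A B [D XD h] [E XE h']; exists (D ∧ E); first exact: (cone_op hX).
    apply: le_and; [apply: le_trans h | apply: le_trans h']; apply: lrc_MD;
      by [apply: ipc_andl | apply: ipc_andr].
- move=> G hG; split.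
  + by exists ROne; [exact: cone_unit hG | exact: thm_K (ipc_top _ _)].
  + by move=> A B hAB [a Ga h]; exists a => //; apply: le_trans h hAB.
  + move=> A B [a Ga h] [b Gb h']; exists (a ⊓ b); first exact: (cone_op hG).
    apply: le_and; [apply: le_trans h | apply: le_trans h']; apply: lrc_MD';
      by [apply: re_meetl | apply: re_meetr].
- move=> Y hY; split.
  + by apply: (cone_up hY) (cone_unit hY); case: (thm_iff (lrc_D2 P R)).
  + by move=> A B hBA; apply: (cone_up hY); apply: lrc_MD.
  + move=> A B YA YB.
    by apply: (cone_up hY) (cone_op hY YA YB); apply: le_dia_or.
- move=> G hG Y hY; split.
  + exists ROne, FBot.
    by split; [exact: cone_unit hG | exact: cone_unit hY | exact: ipc_bot].
  + move=> A B hBA [a [C [Ga YC h]]]; exists a, C; split=> //.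
    exact: le_trans hBA h.
  + move=> A B [a [C [Ga YC h]]] [a' [C' [Ga' YC' h']]].
    (* [▷] is antitone on the left and monotone on the right, so this box lies above both given
       ones. *)
    exists (a ⊓ a'), (C ∨ C').
    split; [exact: (cone_op hG) | exact: (cone_op hY) |].
    apply: le_or; [apply: le_trans h _ | apply: le_trans h' _]; apply: le_box;
      by [apply: re_meetl | apply: re_meetr | apply: ipc_orl | apply: ipc_orr].
- move=> G hG D hD; split.
  + exists ROne, RZero.
    by split; [exact: cone_unit hG | exact: cone_unit hD | exact: ipc_bot].
  + move=> A B hBA [a [b [Ga Db h]]]; exists a, b; split=> //.
    exact: le_trans hBA h.
  + move=> A B [a [b [Ga Db h]]] [a' [b' [Ga' Db' h']]].
    exists (a ⊓ a'), (b ⊔ b').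
    split; [exact: (cone_op hG) | exact: (cone_op hD) |].
    apply: le_or; [apply: le_trans h _ | apply: le_trans h' _]; apply: le_boxR;
      by [apply: re_meetl | apply: re_meetr | apply: re_joinl | apply: re_joinr].
- by move=> p a; apply: cone_ple.
- by move=> p; apply: cone_ple.
- by move=> p X hX Y hY; apply: cone_set_op.
- by move=> p X hX Y hY; apply: cone_set_res.
- by move=> p X hX Y hY; apply: cone_set_res.
- move=> G hG D hD; split.
  + exists ROne, ROne.
    by split; [exact: cone_unit hG | exact: cone_unit hD | exact: re_one].
  + move=> a b hab [g [d [Gg Dd h]]]; exists g, d; split=> //.
    exact: re_trans h hab.
  + move=> a b [g [d [Gg Dd h]]] [g' [d' [Gg' Dd' h']]].
    exists (g ⊓ g'), (d ⊓ d').
    split; [exact: (cone_op hG) | exact: (cone_op hD) |].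
    apply: re_meet; [apply: re_trans h | apply: re_trans h']; apply: re_dot;
      by [apply: re_meetl | apply: re_meetr].
- move=> G hG X hX; split.
  + exists ROne, FTop.
    split; [exact: cone_unit hG | exact: cone_unit hX | exact: thm_K (lrc_B7 _ _)].
  + move=> b b' hb [a [C [Ga XC h]]]; exists a, C; split=> //.
    exact: le_trans h (lrc_MB' _ _ hb).
  + move=> b b' [a [C [Ga XC h]]] [a' [C' [Ga' XC' h']]].
    exists (a ⊓ a'), (C ∧ C').
    split; [exact: (cone_op hG) | exact: (cone_op hX) |].
    apply: le_trans (le_and_boxR_meet _ _ _ _); apply: le_and.
      exact: le_trans (ipc_andl _ _) h.
    exact: le_trans (ipc_andr _ _) h'.
- move=> G hG D hD; split.
  (* Every filter contains [ROne], and the unit law puts [ROne ⋅ RZero] below [RZero]. *)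
  + exists ROne; first exact: cone_unit hG.
    by apply: (cone_up hD) (cone_unit hD); apply: re_dot1l1.
  + move=> b b' hb [a Ga Db]; exists a => //.
    by apply: (cone_up hD) Db; apply: re_MF'.
  + move=> b b' [a Ga Db] [a' Ga' Db']; exists (a ⊓ a').
      exact: (cone_op hG).
    (* The ideal contains [(a ⋅ b) ⊔ (a' ⋅ b')], which by R4 and monotonicity lies above
       [(a ⊓ a') ⋅ (b ⊔ b')]. *)
    apply: (cone_up hD) (cone_op hD Db Db').
    apply: re_trans (re_dot_joinr _ _ _) _.
    apply: re_join; [apply: re_trans (re_joinl _ _) | apply: re_trans (re_joinr _ _)];
      by apply: re_MF; [apply: re_meetl || apply: re_meetr].
- move=> D hD G hG; split.
  + exists ROne; first exact: cone_unit hG.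
    by apply: (cone_up hD) (cone_unit hD); apply: re_dot1r1.
  + move=> b b' hb [a Ga Db]; exists a => //.
    by apply: (cone_up hD) Db; apply: re_MF.
  + move=> b b' [a Ga Db] [a' Ga' Db']; exists (a ⊓ a').
      exact: (cone_op hG).
    apply: (cone_up hD) (cone_op hD Db Db').
    apply: re_trans (re_dot_joinl _ _ _) _.
    apply: re_join; [apply: re_trans (re_joinl _ _) | apply: re_trans (re_joinr _ _)];
      by apply: re_MF'; [apply: re_meetl || apply: re_meetr].
- move=> Y hY; split.
  + by apply: (cone_up hY) (cone_unit hY); case: (thm_iff (lrc_D4 P R)).
  + by move=> a b hba; apply: (cone_up hY); apply: lrc_MD'.
  + move=> a b Ya Yb.
    by apply: (cone_up hY) (cone_op hY Ya Yb); apply: le_diaR_join.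
- move=> X hX Y hY; split.
  + exists FTop, FBot.
    split; [exact: cone_unit hX | exact: cone_unit hY | exact: thm_K (lrc_B2 _)].
  + move=> a a' ha [C [B [XC YB h]]]; exists C, B; split=> //.
    exact: le_trans h (lrc_AB _ ha).
  + move=> a a' [C [B [XC YB h]]] [C' [B' [XC' YB' h']]].
    exists (C ∧ C'), (B ∨ B').
    split; [exact: (cone_op hX) | exact: (cone_op hY) |].
    apply: le_trans (le_and_box _ _ _ _); apply: le_and.
      exact: le_trans (ipc_andl _ _) h.
    exact: le_trans (ipc_andr _ _) h'.
- move=> X hX D hD; split.
  + exists FTop, RZero.
    split; [exact: cone_unit hX | exact: cone_unit hD | exact: thm_K (lrc_B5 _ _)].
  + move=> a a' ha [C [b [XC Db h]]]; exists C, b; split=> //.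
    exact: le_trans h (lrc_AB' _ _ ha).
  + move=> a a' [C [b [XC Db h]]] [C' [b' [XC' Db' h']]].
    exists (C ∧ C'), (b ⊔ b').
    split; [exact: (cone_op hX) | exact: (cone_op hD) |].
    apply: le_trans (le_and_boxR_join _ _ _ _); apply: le_and.
      exact: le_trans (ipc_andl _ _) h.
    exact: le_trans (ipc_andr _ _) h'.
Qed.

(* Every structural connective is monotone for inclusion of filters and ideals
   in all its arguments, whatever their position. *)
Lemma repl_sem A (Z : str P R Fm Suc) t p (S S' : str P R t p) :
    (forall C, ple Suc A C -> sem Z C) ->
  repl A Z S S' -> forall x, sem S x -> sem S' x.
Proof.
move=> hZ; elim=> {t p S S'} //=.
(* Settles the lattice connectives and their residuals, in both positions. *)
all: try by intros; first [apply: set_op_mono | apply: set_res_mono]; eauto.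
- by move=> X X' _ IH C [D /IH XD h]; exists D.
- by move=> X X' _ IH C [D /IH XD h]; exists D.
- by move=> X X' _ IH C /IH.
- by move=> X X' Y _ IH C [a [B [/IH ? ? ?]]]; exists a, B.
- by move=> X Y Y' _ IH C [a [B [? /IH ? ?]]]; exists a, B.
- by move=> X X' Y _ IH C [a [B [/IH ? ? ?]]]; exists a, B.
- by move=> X Y Y' _ IH C [a [B [? /IH ? ?]]]; exists a, B.
- by move=> X X' Y _ IH C [a [B [/IH ? ? ?]]]; exists a, B.
- by move=> X Y Y' _ IH C [a [B [? /IH ? ?]]]; exists a, B.
- by move=> X X' Y _ IH C [a [B [/IH ? ? ?]]]; exists a, B.
- by move=> X Y Y' _ IH C [a [B [? /IH ? ?]]]; exists a, B.
- by move=> X X' Y _ IH C [a /IH ? ?]; exists a.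
- by move=> X Y Y' _ IH C [a ? /IH ?]; exists a.
- by move=> X X' Y _ IH C [a ? /IH ?]; exists a.
- by move=> X Y Y' _ IH C [a /IH ? ?]; exists a.
- by move=> X X' _ IH C /IH.
- by move=> X X' Y _ IH C [a [B [/IH ? ? ?]]]; exists a, B.
- by move=> X Y Y' _ IH C [a [B [? /IH ? ?]]]; exists a, B.
- by move=> X X' Y _ IH C [a [B [/IH ? ? ?]]]; exists a, B.
- by move=> X Y Y' _ IH C [a [B [? /IH ? ?]]]; exists a, B.
Qed.

(** * Validity of the rules of D.LRC *)

Definition valid t (X : str P R t Ant) (Y : str P R t Suc) : Prop :=
  overlap (sem X) (sem Y).

Lemma sem_up t (X : str P R t Ant) x y : le x y -> sem X x -> sem X y.
Proof. exact: (@cone_up _ _ Ant _ _ (cone_sem X)). Qed.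

Lemma sem_down t (Y : str P R t Suc) x y : le x y -> sem Y y -> sem Y x.
Proof. exact: (@cone_up _ _ Suc _ _ (cone_sem Y) y x). Qed.

Lemma valid_prin_l t (x : carrier P R t) (Y : str P R t Suc) :
  overlap (ple Ant x) (sem Y) <-> sem Y x.
Proof. exact: (@overlap_ple P R Ant t x _ (cone_sem Y)). Qed.

Lemma valid_prin_r t (X : str P R t Ant) (y : carrier P R t) :
  overlap (sem X) (ple Suc y) <-> sem X y.
Proof.
have e := @overlap_ple P R Suc t y _ (cone_sem X).
by split=> [/overlapC/e|/e/overlapC].
Qed.

(** Display rules are residuation. Most other one-premise rules keep one side fixed and enlarge the
    cone on the other; the remaining logical rules combine memberships. *)
Lemma soundness t (X : str P R t Ant) (Y : str P R t Suc) : X ⊢ Y -> valid X Y.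
Proof.
have cs := @cone_sem.
elim=> {t X Y}; rewrite /valid /=.
- by move=> p; exists (FAtom p); apply: le_refl.
- by move=> r; exists (RAtom r); apply: re_refl.
(* The second premise puts [A] into the ideal of [Z], so the principal ideal of [A] is included in
   it and [repl_sem] applies. *)
- move=> X X' Y Z A _ h _ /(@valid_prin_l Fm) ZA hr.
  apply: overlap_subl h; apply: repl_sem hr => C hC.
  exact: (@sem_down _ Z _ _ hC ZA).
- move=> X Y Y' Z A _ h _ /(@valid_prin_l Fm) ZA hr.
  apply: overlap_subr h; apply: repl_sem hr => C hC.
  exact: (@sem_down _ Z _ _ hC ZA).
- by move=> G a D _ /(@valid_prin_r Rs) Ga _ /(@valid_prin_l Rs) Da; exists a.
- by move=> X Y Z _ /(@set_op_res P R Suc).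
- by move=> X Y Z _ /(@set_op_res P R Suc).
(* Residuals in antecedent position are the dual instance, with filter and ideal exchanged. *)
- by move=> X Y Z _ /overlapC/(@set_op_res P R Ant)/overlapC.
- by move=> X Y Z _ /overlapC/(@set_op_res P R Ant)/overlapC.
- by move=> X Y Z _ /(@set_op_resC P R Suc).
- by move=> X Y Z _ /(@set_op_resC P R Suc).
- by move=> X Y Z _ /overlapC/(@set_op_resC P R Ant)/overlapC.
- by move=> X Y Z _ /overlapC/(@set_op_resC P R Ant)/overlapC.
- by move=> X Y Z _ /(@set_op_res P R Suc).
- by move=> X Y Z _ /(@set_op_res P R Suc).
- by move=> X Y Z _ /(@set_op_resC P R Suc).
- by move=> X Y Z _ /(@set_op_resC P R Suc).
- by move=> X Y Z _ /overlapC/(@set_op_res P R Ant)/overlapC.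
- by move=> X Y Z _ /overlapC/(@set_op_res P R Ant)/overlapC.
- by move=> X Y Z _ /overlapC/(@set_op_resC P R Ant)/overlapC.
- by move=> X Y Z _ /overlapC/(@set_op_resC P R Ant)/overlapC.
- move=> G D S _ [c [a [b [Ga Db h]]] Sc]; exists b => //; exists a => //.
  exact: (@sem_down _ S _ _ h Sc).
- move=> G D S _ [b Db [a Ga Sab]]; exists (a ⋅ b) => //.
  by exists a, b; split=> //; apply: re_refl.
- move=> G D S _ [c [a [b [Ga Db h]]] Sc]; exists a => //; exists b => //.
  exact: (@sem_down _ S _ _ h Sc).
- move=> G D S _ [a Ga [b Db Sab]]; exists (a ⋅ b) => //.
  by exists a, b; split=> //; apply: re_refl.
- move=> X Y _ [C [D XD h] YC]; exists D => //.
  exact: (@sem_down _ Y _ _ h YC).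
- by move=> X Y _ [D XD YD]; exists (◇ D) => //; exists D => //; apply: le_refl.
- move=> G X _ [C [a Ga h] XC]; exists a => //.
  exact: (@sem_down _ X _ _ h XC).
- by move=> G X _ [a Ga Xa]; exists (◇r a) => //; exists a => //; apply: le_refl.
(* In this and the next five rules the inequality [h] is kept; only the component that serves as
   interpolant changes. *)
- by move=> X G Y _ [C XC [a [B [Ga YB h]]]]; exists a => //; exists C, B.
- by move=> X G Y _ [a Ga [C [B [XC YB h]]]]; exists C => //; exists a, B.
- by move=> X G D _ [C XC [a [b [Ga Db h]]]]; exists b => //; exists a, C.
- by move=> X G D _ [b [a [C [Ga XC h]]] Db]; exists C => //; exists a, b.
- by move=> X G D _ [C XC [a [b [Ga Db h]]]]; exists a => //; exists C, b.
- by move=> X G D _ [a Ga [C [b [XC Db h]]]]; exists C => //; exists a, b.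
- move=> X Y _; apply: overlap_subl => x; apply: set_opr; exact: (cone_ple Ant).
- move=> X Y _; apply: overlap_subl => x; exact: set_op_unit.
- move=> Y X _; apply: overlap_subr => x; apply: set_opl; exact: (cone_ple Suc).
- move=> Y X _; apply: overlap_subr => x /set_opC; exact: set_op_unit.
- move=> X Y Z _; apply: overlap_subl => x; exact: set_opC.
- move=> X Y Z _; apply: overlap_subr => x; exact: set_opC.
- move=> X Y Z _; apply: overlap_subl => x; exact: set_opr.
- move=> X Y Z _; apply: overlap_subr => x; exact: set_opl.
- move=> X Y _; apply: overlap_subl => x; exact: set_op_idem.
- move=> X Y _; apply: overlap_subr => x; exact: set_op_idem.
- move=> X Y Z W _; apply: overlap_subl => x; exact: set_opA.
- move=> X Y Z W _; apply: overlap_subl => x; exact: set_opA'.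
- move=> X Y Z W _; apply: overlap_subr => x; exact: set_opA'.
- move=> X Y Z W _; apply: overlap_subr => x; exact: set_opA.
- move=> G D _; apply: overlap_subl => c [a [b [Ga h1 h]]].
  apply: (@sem_up _ G _ _ _ Ga) => /=; apply: re_trans h.
  exact: re_trans (re_dot1r2 _) (re_MF' _ h1).
- move=> G D _; apply: overlap_subl => a Ga.
  by exists a, ROne; split=> //; [apply: re_refl | apply: re_dot1r1].
- move=> G D _; apply: overlap_subl => a Ga.
  by exists ROne, a; split=> //; [apply: re_refl | apply: re_dot1l1].
- move=> G D _; apply: overlap_subl => c [a [b [h1 Gb h]]].
  apply: (@sem_up _ G _ _ _ Gb) => /=; apply: re_trans h.
  exact: re_trans (re_dot1l2 _) (re_MF _ h1).
- move=> G D _; apply: overlap_subr => x; apply: set_opl; exact: (cone_ple Suc).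
- move=> G D _; apply: overlap_subr => x /set_opC; exact: set_op_unit.
- move=> G D S Q _; apply: overlap_subl => c [a [b [Ga [d [e [Dd Se h]]] h']]].
  exists (a ⋅ d), e; split=> //; first by exists a, d; split=> //; apply: re_refl.
  apply: re_trans (re_dotA2 _ _ _) _; exact: re_trans (re_MF' _ h) h'.
- move=> G D S Q _; apply: overlap_subl => c [a [b [[d [e [Gd De h]]] Sb h']]].
  exists d, (e ⋅ b); split=> //; first by exists e, b; split=> //; apply: re_refl.
  apply: re_trans (re_dotA1 _ _ _) _; exact: re_trans (re_MF _ h) h'.
(* The filter generated by [ROne] is included in every filter. *)
- move=> G D _; apply: overlap_subl => x h1.
  exact: (@sem_up _ G _ _ h1 (cone_unit (cs _ _ G))).
- move=> G D S _; apply: overlap_subl => x; exact: set_opl.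
- move=> G D S _; apply: overlap_subr => x; exact: set_opl.
- move=> X Y _; apply: overlap_subl => x; exact: set_op_idem.
- move=> X Y _; apply: overlap_subr => x; exact: set_op_idem.
- move=> X Y Z _; apply: overlap_subl => x; exact: set_opC.
- move=> X Y Z _; apply: overlap_subr => x; exact: set_opC.
- move=> X Y Z W _; apply: overlap_subl => x; exact: set_opA.
- move=> X Y Z W _; apply: overlap_subl => x; exact: set_opA'.
- move=> X Y Z W _; apply: overlap_subr => x; exact: set_opA.
- move=> X Y Z W _; apply: overlap_subr => x; exact: set_opA'.
(* The target is a cone, so it suffices to include each component; R4 enters through [cone_sem]. The
   other rules splitting [,,] or [⨟] under an adjoint go the same way. *)
- move=> G D S Q _; apply: overlap_subr => c.
  apply: (set_op_sub (cs _ _ (G ⋗ (D ,, S)))) => d [a Ga h]; exists a => //.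
    exact: (set_opl (cs _ _ S)).
  exact: (set_opr (cs _ _ D)).
- move=> X Y Z _; apply: overlap_subr => C.
  apply: (set_op_sub (cs _ _ (● (Y ⨟ Z)))) => D h.
    exact: (set_opl (cs _ _ Z)).
  exact: (set_opr (cs _ _ Y)).
- move=> G Y Z _; apply: overlap_subr => C.
  apply: (set_op_sub (cs _ _ (●r (Y ⨟ Z)))) => D h.
    exact: (set_opl (cs _ _ Z)).
  exact: (set_opr (cs _ _ Y)).
(* The ideal generated by [FBot] is included in every ideal, in particular in that of [● SI]. *)
- move=> X _; apply: overlap_subr => C h.
  exact: (@sem_down _ (● SI) _ _ h (cone_unit (cs _ _ (● SI)))).
- move=> G _; apply: overlap_subr => a h.
  exact: (@sem_down _ (●r SI) _ _ h (cone_unit (cs _ _ (●r SI)))).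
- move=> G Y Z D _; apply: overlap_subr => a.
  apply: (set_op_sub (cs _ _ ((Y ⨟ Z) ▶^r D))) => b [C [d [h1 h2 h3]]];
    exists C, d; split=> //.
    exact: (set_opl (cs _ _ Z)).
  exact: (set_opr (cs _ _ Y)).
- move=> G Y Z W _; apply: overlap_subr => a.
  apply: (set_op_sub (cs _ _ ((Y ⨟ Z) ▶^ W))) => b [C [d [h1 h2 h3]]];
    exists C, d; split=> //.
    exact: (set_opl (cs _ _ Z)).
  exact: (set_opr (cs _ _ Y)).
- move=> G X Y D _; apply: overlap_subl => a.
  apply: (set_op_sub (cs _ _ (G ▲^r (X ⨟ Y)))) => b [c [C [h1 h2 h3]]];
    exists c, C; split=> //.
    exact: (set_opl (cs _ _ Y)).
  exact: (set_opr (cs _ _ X)).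
- move=> X G D Y _; apply: overlap_subr => C [a [B [Ga [b [E [Db YE h]]] h']]].
  exists (a ⋅ b), E; split=> //; first by exists a, b; split=> //; apply: re_refl.
  by apply: le_trans h' _; apply: le_trans (lrc_B3 _ _ _); apply: lrc_MB.
- move=> G D _; apply: overlap_subl => a h.
  exact: (@sem_up _ (G ▲^r SI) _ _ h (cone_unit (cs _ _ (G ▲^r SI)))).
- move=> X G Y _; apply: overlap_subr => C [a [B [Ga YB h]]].
  (* BD1 bounds [◇r a ∧ C] by [◇ B], since [C] entails [a ▷ B]. *)
  exists (◇r a), (◇ B); split=> //; first by exists a => //; apply: le_refl.
  apply: le_trans (lrc_BD1 _ _); apply: le_and; first exact: ipc_andl.
  exact: le_trans (ipc_andr _ _) h.
- move=> X G Y _; apply: overlap_subr => C [a [b [Ga Yb h]]].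
  exists a, (◇r b); split=> //; exact: le_trans h (lrc_BD2 _ _ _).
- by exists FBot; apply: le_refl.
(* [SI] in succedent position and [FBot] have the same interpretation; next, so do [SI] in
   antecedent position and [FTop]. *)
- by [].
- by [].
- by exists FTop; apply: le_refl.
- move=> A B X _; apply: overlap_subl => C.
  apply: (set_op_sub (cone_ple Ant (A ∧ B : carrier P R Fm))) => D;
    apply: le_trans; [exact: ipc_andl | exact: ipc_andr].
- move=> A B X Y _ /(@valid_prin_r Fm) XA _ /(@valid_prin_r Fm) YB.
  apply/(@valid_prin_r Fm (X ⨟ Y)); exact: (@set_op_le P R Ant Fm _ _ _ _ XA YB).
- move=> A B X Y _ /(@valid_prin_l Fm) XA _ /(@valid_prin_l Fm) YB.
  apply/(@valid_prin_l Fm _ (X ⨟ Y)); exact: (@set_op_le P R Suc Fm _ _ _ _ XA YB).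
- move=> A B X _; apply: overlap_subr => C.
  apply: (set_op_sub (cone_ple Suc (A ∨ B : carrier P R Fm))) => D h;
    apply: le_trans h _; [exact: ipc_orl | exact: ipc_orr].
- move=> A B X Y _ /(@valid_prin_r Fm) XA _ /(@valid_prin_l Fm) YB.
  apply/(@valid_prin_l Fm _ (X ≻ Y)); exists A, B; split=> //.
  by apply/le_imp; apply: le_refl.
- move=> A B X _; apply: overlap_subr => C [D [E [hD hE h]]].
  apply/le_imp; apply: le_trans hE; apply: le_trans h.
  apply: le_and; last exact: ipc_andr.
  exact: le_trans (ipc_andl _ _) hD.
- by exists RZero; apply: re_refl.
- by [].
- by [].
- by exists ROne; apply: re_refl.
- move=> a b G _; apply: overlap_subl => c [d [e [hd he]]]; apply: re_trans.
  exact: re_dot.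
- move=> a b G D _ /(@valid_prin_r Rs) Ga _ /(@valid_prin_r Rs) Db.
  by exists (a ⋅ b); [exists a, b; split=> // |]; apply: re_refl.
- move=> a b X Y _ /(@valid_prin_l Rs) XA _ /(@valid_prin_l Rs) YB.
  apply/(@valid_prin_l Rs _ (X ,, Y)); exact: (@set_op_le P R Suc Rs _ _ _ _ XA YB).
- move=> a b X _; apply: overlap_subr => c.
  apply: (set_op_sub (cone_ple Suc (a ⊔ b : carrier P R Rs))) => d h;
    apply: re_trans h _; [exact: re_joinl | exact: re_joinr].
- move=> a b X _; apply: overlap_subl => c.
  apply: (set_op_sub (cone_ple Ant (a ⊓ b : carrier P R Rs))) => d;
    apply: re_trans; [exact: re_meetl | exact: re_meetr].
- move=> a b X Y _ /(@valid_prin_r Rs) XA _ /(@valid_prin_r Rs) YB.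
  apply/(@valid_prin_r Rs (X ,, Y)); exact: (@set_op_le P R Ant Rs _ _ _ _ XA YB).
- move=> A X _; apply: overlap_subl => C [D hD]; apply: le_trans.
  exact: lrc_MD.
- move=> A X _ /(@valid_prin_r Fm) XA.
  by exists (◇ A); [exists A => // |]; apply: le_refl.
- move=> a A G X _ /(@valid_prin_r Rs) Ga _ /(@valid_prin_l Fm) XA.
  by exists (a ▷ A); [|exists a, A; split=> //]; apply: le_refl.
(* Here [b] is above [a] and [B] below [A], so [b ▷ B] entails [a ▷ A]. *)
- move=> a A X _; apply: overlap_subr => C [b [B [hb hB h]]].
  by apply: le_trans h _; apply: le_box.
- move=> a X _; apply: overlap_subl => C [b hb]; apply: le_trans.
  exact: lrc_MD'.
- move=> a G _ /(@valid_prin_r Rs) Ga.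
  by exists (◇r a); [exists a => // |]; apply: le_refl.
- move=> a b G D _ /(@valid_prin_r Rs) Ga _ /(@valid_prin_l Rs) Db.
  by exists (a ▷r b); [|exists a, b; split=> //]; apply: le_refl.
- move=> a b X _; apply: overlap_subr => C [c [d [hc hd h]]].
  by apply: le_trans h _; apply: le_boxR.
Qed.

End Soundness.

Theorem mainTheorem7 (AtProp AtRes : countType) (A B : fm AtProp AtRes) :
  Fml A ⊢ Fml B -> lrc_entails A B.
Proof. by move=> /soundness [C]; apply: le_trans. Qed.
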